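(* Let $\nu\in\mathcal P_2(\mathbb R)$ and let $F_\nu \colon L_2(0,1)\to\mathbb R$ be given by $F_\nu(u) = \int_0^1 \big( (1-2s)\,u(s) + \int_0^1 |u(s)-Q_\nu(t)|\,dt \big) ds$. For every $u \in L_2(0,1)$ it holds $$\partial F_\nu(u) = \big\{ f \in L_2(0,1) : f(s) \in 2\big[R_\nu^-(u(s)), R_\nu^+(u(s))\big] - 2s \ \text{ for a.e. } s\in(0,1) \big\}.$$ In particular, $\operatorname{dom}(\partial F_\nu) = L_2(0,1)$.
   Context: $\mathcal P_2(\mathbb R)$ is the set of Borel probability measures on $\mathbb R$ with finite second moment. For such $\nu$: $R_\nu^+(x) := \nu((-\infty,x])$, $R_\nu^-(x) := \nu((-\infty,x))$ and $Q_\nu(s) := \min\{x \in \mathbb R : R_\nu^+(x) \ge s\}$, $s\in(0,1)$. The subdifferential is $\partial F(u) := \{ v \in L_2(0,1) : F(w) \ge F(u) + \langle v, w-u\rangle + o(\|w-u\|) \text{ for all } w \in L_2(0,1)\}$ (for convex $F$ the $o$-term can be omitted), and $\operatorname{dom}(\partial F) := \{u\in L_2(0,1) : \partial F(u)\neq\emptyset\}$. For an interval $[a,b]$, $2[a,b]-2s := [2a-2s,2b-2s]$. *)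

(* Defs.v *)
From HB Require Import structures.
From mathcomp Require Import all_boot all_order all_algebra.
From mathcomp Require Import all_classical all_reals all_analysis.

Set Implicit Arguments.
Unset Strict Implicit.
Unset Printing Implicit Defensive.
Import Order.TTheory GRing.Theory Num.Theory.
Import numFieldNormedType.Exports.
Local Open Scope classical_set_scope.
Local Open Scope ring_scope.

(* Lebesgue measure on (0,1), as a measure on R concentrated on ]0, 1[. *)
Definition leb01 (R : realType) : {measure set (measurableTypeR R) -> \bar R} :=
  mrestr lebesgue_measure (measurable_itv `](0:R), 1[).

(* L_2(0,1) as equivalence classes modulo a.e. equality.  An element [u]
   coerces to a chosen representative, so that [u s] makes sense. *)
Definition L2 (R : realType) : Type := LspaceType2 (leb01 R).

Definition L2dot (R : realType) (f g : R -> R) : R :=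
  \int[leb01 R]_s (f s * g s).

Definition L2norm (R : realType) (f : R -> R) : R :=
  fine ('N[leb01 R]_2 [EFin \o f])%E.

(* The o-term is spelled out: v is in the subdifferential of F at u when
   F w >= F u + <v, w - u> - e ||w - u|| for every e > 0 and all w close
   enough to u (depending on e). *)
Definition subdifferential (R : realType) (F : L2 R -> R) (u : L2 R) :
    set (L2 R) :=
  [set v | forall e : R, 0 < e -> exists2 d : R, 0 < d &
    forall w : L2 R, L2norm (w \- u) < d ->
      F u + L2dot v (w \- u) - e * L2norm (w \- u) <= F w].

Definition subdiff_dom (R : realType) (F : L2 R -> R) : set (L2 R) :=
  [set u | subdifferential F u !=set0].

Definition finite_second_moment (R : realType)
    (nu : probability (measurableTypeR R) R) : Prop :=
  (\int[nu]_x (x ^+ 2)%:E < +oo)%E.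

Definition cdf_le (R : realType) (nu : probability (measurableTypeR R) R)
    (x : R) : R := fine (nu `]-oo, x]%classic).

Definition cdf_lt (R : realType) (nu : probability (measurableTypeR R) R)
    (x : R) : R := fine (nu `]-oo, x[%classic).

(* The minimum of {x | s <= cdf_le nu x}; it exists for s in (0,1), and the
   default value 0 is only taken outside of that interval. *)
Definition quantile (R : realType) (nu : probability (measurableTypeR R) R)
    (s : R) : R :=
  let A := [set x : R | s <= cdf_le nu x] in xget 0 (A `&` lbound A).

Definition Fnu (R : realType) (nu : probability (measurableTypeR R) R)
    (u : L2 R) : R :=
  \int[leb01 R]_s ((1 - 2 * s) * u s
                   + \int[leb01 R]_t `|u s - quantile nu t|).

(* Main.v *)
Require Import Defs.
From HB Require Import structures.
From mathcomp Require Import all_boot all_order all_algebra.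
From mathcomp Require Import all_classical all_reals all_analysis.
From mathcomp Require Import measurable_realfun.
From mathcomp Require Import lra.
Set Implicit Arguments.
Unset Strict Implicit.
Unset Printing Implicit Defensive.
Import Order.TTheory GRing.Theory Num.Theory.
Import numFieldNormedType.Exports.
Local Open Scope classical_set_scope.
Local Open Scope ring_scope.

(** Put [potential x = E_nu |x - Y|] for Y of law nu.  The proof has two layers.

    Reduction to a one-variable convex function.  On (0,1) the quantile function
    is the generalized inverse of the distribution function,
    [quantile_le : (quantile s <= x) = (s <= cdf_le x)], so it pushes Lebesgue
    measure forward to nu ([pushforward_quantile]).  Hence the inner integral
    defining [Fnu] is [potential (u s)], and [Fnu u] is the integral over s of
    [integrand s (u s)], where [integrand s x = (1 - 2 s) x + potential x].
    Averaging over q the subgradients of [y |-> |y - q|] shows that 2 p - 1 is a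
    subgradient of [potential] at x as soon as [cdf_lt x <= p <= cdf_le x]
    ([potential_subgrad]).  The same inequality, read at the other
    endpoint, bounds the increments of [potential] from above
    ([potential_incr]).

    Passage to L_2(0,1).  If [f s] lies in the announced interval for almost
    every s, integrating the pointwise subgradient inequality over s shows that f
    is a subgradient, without any error term ([subgradient_of_ae]).

    Conversely, let v be in the subdifferential at u.  It is tested on
    [w = u + sigma t 1_A], with A measurable, [sigma = 1] or [-1], and t small;
    then [||w - u|| <= t], so that after division by t the error term is at most
    the prescribed e.  Bounding the increment of [Fnu] by [potential_incr]
    gives
      [int_A sigma (v s - (2 cdf_le (u s + sigma t) - 2 s)) ds <= e].
    As t tends to 0, [cdf_le (x + sigma t)] tends to the right or left limit
    of the distribution function, that is [cdf_le x] when [sigma = 1] and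
    [cdf_lt x] when [sigma = -1]; dominated convergence removes t, and e is
    arbitrary ([int_gap_le0]).  Taking for A the set where the integrand is
    positive forces that set to be negligible ([subdifferential_one_side]).  The
    two signs give the two endpoints of the interval.

    The subdifferential is never empty because the upper endpoint
    [2 cdf_le (u s) - 2 s] is a bounded measurable function of s, hence an element
    of L_2(0,1). *)

(** * Distribution function and quantile function *)

Section cdf.
Context {R : realType} (nu : probability (measurableTypeR R) R).

Lemma EFin_cdf_le x : (cdf_le nu x)%:E = nu `]-oo, x]%classic.
Proof. by rewrite fineK// fin_num_measure. Qed.

Lemma EFin_cdf_lt x : (cdf_lt nu x)%:E = nu `]-oo, x[%classic.
Proof. by rewrite fineK// fin_num_measure. Qed.

Lemma cdf_le_ge0 x : 0 <= cdf_le nu x.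
Proof. by rewrite -lee_fin EFin_cdf_le. Qed.

Lemma cdf_le_le1 x : cdf_le nu x <= 1.
Proof. by rewrite -lee_fin EFin_cdf_le probability_le1. Qed.

Lemma cdf_lt_le x : cdf_lt nu x <= cdf_le nu x.
Proof.
rewrite -lee_fin EFin_cdf_le EFin_cdf_lt le_measure ?inE//.
by apply: subset_itvl; rewrite bnd_simp.
Qed.

Lemma cdf_lt_le1 x : cdf_lt nu x <= 1.
Proof. exact: le_trans (cdf_lt_le x) (cdf_le_le1 x). Qed.

Lemma cdf_le_nd : nondecreasing_fun (cdf_le nu).
Proof.
move=> x y xy; rewrite -lee_fin !EFin_cdf_le le_measure ?inE//.
by apply: subset_itvl; rewrite bnd_simp.
Qed.

Lemma cdf_lt_nd : nondecreasing_fun (cdf_lt nu).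
Proof.
move=> x y xy; rewrite -lee_fin !EFin_cdf_lt le_measure ?inE//.
by apply: subset_itvl; rewrite bnd_simp.
Qed.

Lemma measurable_cdf_le : measurable_fun setT (cdf_le nu).
Proof. exact: nondecreasing_measurable cdf_le_nd. Qed.

Lemma measurable_cdf_lt : measurable_fun setT (cdf_lt nu).
Proof. exact: nondecreasing_measurable cdf_lt_nd. Qed.

Lemma cvg_cdf_le_right x :
  cdf_le nu (x + n.+1%:R^-1) @[n --> \oo] --> cdf_le nu x.
Proof.
apply: fine_cvg; rewrite EFin_cdf_le (itvNycEbigcap false).
pose F n := `]-oo, x + n.+1%:R^-1]%classic.
apply: (@nonincreasing_cvg_mu _ _ _ nu F).
- by rewrite ltey_eq fin_num_measure//; exact: measurable_itv.
- by move=> n; exact: measurable_itv.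
- by apply: bigcapT_measurable => n; exact: measurable_itv.
- move=> m n mn; apply/subsetPset; apply: subset_itvl.
  by rewrite bnd_simp lerD2l lef_pV2 ?posrE// ler_nat.
Qed.

(** The limit from the left is [cdf_lt], which is how the lower endpoint of the
    subdifferential arises from values of [cdf_le] alone. *)
Lemma cvg_cdf_le_left x :
  cdf_le nu (x - n.+1%:R^-1) @[n --> \oo] --> cdf_lt nu x.
Proof.
apply: fine_cvg; rewrite EFin_cdf_lt -setCitvr itvcyEbigcap setC_bigcap.
under eq_bigcupr do rewrite setCitvr.
pose F n := `]-oo, x - n.+1%:R^-1]%classic.
apply: (@nondecreasing_cvg_mu _ _ _ nu F).
- by move=> n; exact: measurable_itv.
- by apply: bigcupT_measurable => n; exact: measurable_itv.
- move=> m n mn; apply/subsetPset; apply: subset_itvl.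
  by rewrite bnd_simp lerD2l lerN2 lef_pV2 ?posrE// ler_nat.
Qed.

Lemma cdf_le_near1 s : s < 1 -> exists x, s <= cdf_le nu x.
Proof.
move=> s1.
have : nu `]-oo, n%:R]%classic @[n --> \oo] --> (1 : \bar R)%E.
  rewrite -(probability_setT nu).
  have <- : \bigcup_n `]-oo, n%:R]%classic = [set: R].
    rewrite -subTset => t _/=; exists (Num.truncn t).+1 => //=.
    by rewrite in_itv/= ltW// truncnS_gt.
  apply: nondecreasing_cvg_mu.
  + by move=> n; exact: measurable_itv.
  + by apply: bigcupT_measurable => n; exact: measurable_itv.
  + move=> m n mn; apply/subsetPset; apply: subset_itvl.
    by rewrite bnd_simp ler_nat.
move/fine_cvg => /= /cvgrPdist_lt /(_ (1 - s)).
rewrite subr_gt0 => /(_ s1) [N _ /(_ N (leqnn N))] /=.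
rewrite -/(cdf_le nu N%:R) => h; exists N%:R.
by move: h; rewrite ltr_norml; lra.
Qed.

Lemma cdf_le_near0 s : 0 < s -> exists x, cdf_le nu x < s.
Proof.
move=> s0.
have : nu `]-oo, - n%:R]%classic @[n --> \oo] --> (0 : \bar R)%E.
  rewrite -(measure0 nu).
  have <- : \bigcap_n `]-oo, (- n%:R)]%classic = @set0 R.
    rewrite -subset0 => t /(_ (Num.truncn (- t)).+1 I) /=.
    by rewrite in_itv/= leNgt => /negP; apply; rewrite ltrNl truncnS_gt.
  apply: nonincreasing_cvg_mu => //=.
  + by rewrite ltey_eq fin_num_measure//; exact: measurable_itv.
  + by apply: bigcapT_measurable => n; exact: measurable_itv.
  + move=> m n mn; apply/subsetPset; apply: subset_itvl.
    by rewrite bnd_simp lerN2 ler_nat.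
move/fine_cvg => /= /cvgrPdist_lt /(_ s s0) [N _ /(_ N (leqnn N))] /=.
rewrite -/(cdf_le nu (- N%:R)) => h; exists (- N%:R).
by move: h; rewrite ltr_norml; lra.
Qed.

(** The set [A] of which [quantile] is the minimum is nonempty and bounded below
    because [cdf_le] tends to 1 and 0 at infinity; right continuity puts its
    infimum in [A], so the minimum exists and [A] is a closed half-line. *)
Lemma quantile_le s x : 0 < s < 1 -> (quantile nu s <= x) = (s <= cdf_le nu x).
Proof.
move=> /andP[s0 s1]; rewrite /quantile.
set A := [set x : R | s <= cdf_le nu x].
have [a Aa] : A !=set0 by have [a] := cdf_le_near1 s1; exists a.
have [b bs] := cdf_le_near0 s0.
have lbA : has_lbound A.
  exists b => y Ay; rewrite leNgt; apply/negP => /ltW /cdf_le_nd.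
  by move=> /(le_trans Ay); rewrite leNgt bs.
have hA : has_inf A by split => //; exists a.
have Ainf : A (inf A).
  rewrite /A /= -(cvg_lim _ (@cvg_cdf_le_right (inf A)))//.
  apply: limr_ge; first exact: cvgP (@cvg_cdf_le_right _).
  apply: nearW => n.
  have [y Ay yn] := inf_adherent (ltac:(by []) : 0 < n.+1%:R^-1 :> R) hA.
  exact: le_trans Ay (cdf_le_nd (ltW yn)).
have lbinf : lbound A (inf A) by move=> y Ay; exact: ge_inf.
case: xgetP => [q -> [Aq lbq]|/(_ (inf A))]; last by case.
apply/idP/idP => [qx|]; first exact: le_trans Aq (cdf_le_nd qx).
exact: lbq.
Qed.

End cdf.

(** * Lebesgue measure on the unit interval *)

(* Type class resolution does not unfold [leb01] to a measure by itself. *)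
#[global] Instance ae_leb01_filter (R : realType) :
  Filter (almost_everywhere (leb01 R)) := ae_filter_ringOfSetsType (leb01 R).

Section unit_interval.
Context {R : realType}.

Lemma leb01_itvNyc (a : R) : 0 <= a <= 1 -> leb01 R `]-oo, a]%classic = a%:E.
Proof.
move=> /andP[a0 a1]; rewrite /leb01/= /mrestr.
have [a_lt1|] := ltP a 1.
  have -> : `]-oo, a]%classic `&` `]0, 1[%classic = `]0, a]%classic.
    apply/seteqP; split => x /=; rewrite !in_itv/=; first by case=> -> /andP[->].
    by move=> /andP[-> xa]; rewrite xa (le_lt_trans xa).
  rewrite lebesgue_measure_itv/= lte_fin sube0.
  by case: ltP a0 => // a0 a0'; congr EFin; apply/eqP; rewrite eq_le a0 a0'.
move=> a1'; have -> : a = 1 by apply/eqP; rewrite eq_le a1 a1'.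
rewrite setIidr; first by rewrite lebesgue_measure_itv/= lte_fin ltr01 sube0.
by move=> x /=; rewrite !in_itv/= => /andP[_ /ltW].
Qed.

Lemma leb01T : leb01 R setT = 1%E.
Proof.
rewrite /leb01/= /mrestr setTI lebesgue_measure_itv/= lte_fin ltr01.
by rewrite sube0.
Qed.

Lemma ae_leb01 : {ae leb01 R, forall s, 0 < s < 1}.
Proof.
exists (~` `]0, 1[); split.
- exact: measurableC.
- by rewrite /leb01/= /mrestr setICl measure0.
- by move=> s /= h; rewrite in_itv.
Qed.

(** The open half-lines unbounded above form a pi-system generating the Borel
    sets, and their masses are complementary to those of the closed half-lines
    unbounded below. *)
Lemma probability_eq_cdf (m1 m2 : {measure set (measurableTypeR R) -> \bar R}) :
  m1 setT = 1%E -> m2 setT = 1%E ->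
  (forall x, m1 `]-oo, x]%classic = m2 `]-oo, x]%classic) ->
  forall A, measurable A -> m1 A = m2 A.
Proof.
move=> m1T m2T m12.
have fin1 A : measurable A -> (m1 A < +oo)%E.
  move=> mA; rewrite (@le_lt_trans _ _ 1%E) ?ltry// -m1T le_measure ?inE//.
have fin2 A : measurable A -> (m2 A < +oo)%E.
  move=> mA; rewrite (@le_lt_trans _ _ 1%E) ?ltry// -m2T le_measure ?inE//.
pose g n : set (measurableTypeR R) := `](- n%:R), +oo[%classic.
apply: (@measure_unique _ R (measurableTypeR R) (@RGenOInfty.G R) g).
- exact: RGenOInfty.measurableE.
- move=> _ _ [x ->] [y ->]; exists (Num.max x y); apply/seteqP; split => z /=;
    by rewrite !in_itv/= !andbT gt_max => /andP.
- by move=> n; exists (- n%:R).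
- rewrite -subTset => x _; exists (Num.truncn (- x)).+1 => //=.
  by rewrite /g/= in_itv/= andbT ltrNl truncnS_gt.
- move=> _ [x ->]; rewrite -setCitvl -setTD !measureD//.
  + by rewrite !setTI; congr (_ - _)%E; [rewrite [LHS]m1T [RHS]m2T|exact: m12].
  + exact: fin2.
  + exact: fin1.
- by move=> n; apply: fin1; exact: measurable_itv.
Qed.

Context (nu : probability (measurableTypeR R) R).

(** The quantile function is monotone, hence easily seen to be measurable, only
    on the unit interval; the truncation by 0 is a function on the whole line that
    agrees with it almost everywhere. *)
Definition quantile01 : measurableTypeR R -> measurableTypeR R :=
  quantile nu \_ `]0, 1[.

Lemma measurable_quantile01 : measurable_fun setT quantile01.
Proof.
apply/(measurable_restrictT (quantile nu)) => //.
apply: (measurability (@RGenOInfty.G R)) => [|_ [_] [x ->] <-].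
  exact: RGenOInfty.measurableE.
rewrite [X in measurable X](_ : _ = `]0, 1[ `&` `]cdf_le nu x, +oo[).
  by apply: measurableI; exact: measurable_itv.
have E s : 0 < s < 1 -> (x < quantile nu s) = (cdf_le nu x < s).
  by move=> s01; rewrite !ltNge quantile_le.
by apply/seteqP; split => s /=; rewrite !in_itv/= !andbT => -[s01] h;
  split => //; move: h; rewrite E.
Qed.

(** [quantile s <= x] means [s <= cdf_le x], and the set of such s has Lebesgue
    measure [cdf_le x]: both measures have the same distribution function. *)
Lemma pushforward_quantile A : measurable A ->
  pushforward (leb01 R) quantile01 A = nu A.
Proof.
have mQ := measurable_quantile01.
apply: (probability_eq_cdf (m1 := pushforward (leb01 R) quantile01)).
- exact: leb01T.
- exact: probability_setT.
- move=> x; transitivity (cdf_le nu x)%:E; last exact: EFin_cdf_le.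
  rewrite -leb01_itvNyc ?cdf_le_ge0 ?cdf_le_le1//.
  rewrite /pushforward /leb01/= /mrestr; congr (lebesgue_measure _).
  apply/seteqP; split => s /=; rewrite !in_itv/= => -[h s01]; split => //;
  by move: h; rewrite /quantile01 patchE mem_set ?in_itv//= quantile_le.
Qed.

End unit_interval.

(** * The potential of a measure and its subgradients *)

Section potential.
Context {R : realType} (nu : probability (measurableTypeR R) R).

(** Outside of ]0, 1] the set defining the quantile is empty or the whole line,
    so the default value is taken. *)
Lemma quantile_out s : ~~ (0 < s <= 1) -> quantile nu s = 0.
Proof.
move=> s01; rewrite /quantile; case: xgetP => // q _ [/= sq lbq].
move: s01; rewrite (le_trans sq (cdf_le_le1 _ _)) andbT -leNgt => s0.
have /lbq : s <= cdf_le nu (q - 1) by rewrite (le_trans s0)// cdf_le_ge0.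
by rewrite leNgt ltrBlDr ltrDl ltr01.
Qed.

(** Needed because changing an integrand almost everywhere requires both
    functions to be measurable on the whole line. *)
Lemma measurable_quantile :
  measurable_fun setT (quantile nu : measurableTypeR R -> measurableTypeR R).
Proof.
have -> : quantile nu = fun s : measurableTypeR R =>
    quantile01 nu s + quantile nu 1 * \1_[set 1%R] s.
  apply/funext => s; rewrite /quantile01 patchE indicE.
  have -> : (s \in [set 1]) = (s == 1) by apply/idP/eqP; rewrite inE.
  have [->|s1] := eqVneq s 1.
    by rewrite memNset ?add0r ?mulr1//= in_itv/= ltxx andbF.
  rewrite mulr0 addr0; case: ifPn => // /negP s01.
  apply: quantile_out; apply/negP => /andP[s0]; rewrite le_eqVlt (negbTE s1)/=.
  by move=> s1'; apply: s01; rewrite inE/= in_itv/= s0.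
apply: measurable_funD; first exact: measurable_quantile01.
by apply: measurable_funM => //; exact: measurable_indic.
Qed.

Definition potential (x : R) : R := \int[nu]_y `|x - y|.

Lemma Rintegral_quantile x :
  \int[leb01 R]_t `|x - quantile nu t| = potential x.
Proof.
have mx : measurable_fun setT (fun y : measurableTypeR R => (`|x - y|)%:E).
  apply/measurable_EFinP/measurableT_comp => //.
  exact: measurable_funB.
rewrite /potential /Rintegral; congr fine.
transitivity (\int[leb01 R]_t (`|x - quantile01 nu t|)%:E)%E.
  apply: ae_eq_integral => //.
  - exact: (measurableT_comp mx measurable_quantile).
  - exact: (measurableT_comp mx (measurable_quantile01 nu)).
  - move: (@ae_leb01 R); apply: filterS => s s01 _ /=.
    by rewrite /quantile01 patchE mem_set// in_itv.
rewrite -(@ge0_integral_pushforward _ _ _ _ _ _ (measurable_quantile01 nu)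
  (leb01 R) setT (fun y => (`|x - y|)%:E))//.
have mQ := measurable_quantile01 nu.
apply: (eq_measure_integral nu) => A mA _; exact: (pushforward_quantile nu mA).
Qed.

(** The function [2 * \1_A - 1] is 1 on A and -1 off A.  When A is the half-line
    of points at most x, or of points below x, its value at q is a subgradient at
    x of the distance to q. *)
Lemma integrable_indic_slope A c : measurable A ->
  nu.-integrable setT (EFin \o (fun y => c * (2 * \1_A y - 1))).
Proof.
move=> mA.
have iA : nu.-integrable setT (EFin \o \1_A) by exact: integrable_indic.
have i2A : nu.-integrable setT (EFin \o (fun y => 2 * \1_A y)).
  exact: (integrableZl measurableT 2 iA).
have i1 : nu.-integrable setT (EFin \o cst 1).
  exact: finite_measure_integrable_cst.
exact: (integrableZl measurableT c (integrableB measurableT i2A i1)).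
Qed.

Lemma Rintegral_indic_slope A c : measurable A ->
  \int[nu]_y (c * (2 * \1_A y - 1)) = c * (2 * fine (nu A) - 1).
Proof.
move=> mA.
have iA : nu.-integrable setT (EFin \o \1_A) by exact: integrable_indic.
have i2A : nu.-integrable setT (EFin \o (fun y => 2 * \1_A y)).
  exact: (integrableZl measurableT 2 iA).
have i1 : nu.-integrable setT (EFin \o cst 1).
  exact: finite_measure_integrable_cst.
rewrite RintegralZl//; last exact: (integrableB measurableT i2A i1).
rewrite RintegralB// RintegralZl//.
rewrite /Rintegral integral_indic// setIT integral_cst// mul1e.
congr (_ * (_ - _)); exact: (congr1 fine (probability_setT nu)).
Qed.

Hypothesis nu2 : finite_second_moment nu.

Lemma integrable_dist x : nu.-integrable setT (fun y => (`|x - y|)%:E).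
Proof.
have i2 : nu.-integrable setT (fun y => (y ^+ 2)%:E).
  apply/integrableP; split.
    by apply/measurable_EFinP; exact: measurable_funX.
  under eq_integral do rewrite gee0_abs ?lee_fin ?sqr_ge0//.
  exact: nu2.
have i1 : nu.-integrable setT (EFin \o cst (`|x| + 1)).
  exact: finite_measure_integrable_cst.
apply: le_integrable (integrableD measurableT i2 i1) => //.
  by apply/measurable_EFinP/measurableT_comp => //; exact: measurable_funB.
move=> y _ /=; rewrite lee_fin normr_id.
rewrite [leRHS]ger0_norm; last by rewrite addr_ge0 ?sqr_ge0// addr_ge0.
rewrite (le_trans (ler_normB _ _))// addrCA lerD2l.
have [_|_] := ler0P y; nra.
Qed.

(** Increasing x to y moves away from the points q <= x at full speed, and
    towards the other points at most at full speed. *)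
Lemma potential_slope_right x y : x <= y ->
  (y - x) * (2 * cdf_le nu x - 1) <= potential y - potential x.
Proof.
move=> xy; rewrite /potential -RintegralB//; try exact: integrable_dist.
rewrite /cdf_le -Rintegral_indic_slope//; apply: le_Rintegral => //.
- exact: integrable_indic_slope.
- exact: (integrableB measurableT (integrable_dist y) (integrable_dist x)).
- move=> q _; rewrite indicE; have [qx|qx] := leP q x.
    rewrite mem_set ?in_itv//= !ger0_norm; nra.
  rewrite memNset; last by rewrite /= in_itv/= leNgt qx.
  rewrite mulr0 (ltr0_norm (x := x - q)) ?subr_lt0//.
  have : - (y - q) <= `|y - q| by rewrite -normrN ler_norm.
  nra.
Qed.

Lemma potential_slope_left x y : y <= x ->
  (y - x) * (2 * cdf_lt nu x - 1) <= potential y - potential x.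
Proof.
move=> yx; rewrite /potential -RintegralB//; try exact: integrable_dist.
rewrite /cdf_lt -Rintegral_indic_slope//; apply: le_Rintegral => //.
- exact: integrable_indic_slope.
- exact: (integrableB measurableT (integrable_dist y) (integrable_dist x)).
- move=> q _; rewrite indicE; have [qx|qx] := ltP q x.
    rewrite mem_set ?in_itv//= (gtr0_norm (x := x - q)) ?subr_gt0//.
    have : y - q <= `|y - q| by rewrite ler_norm.
    nra.
  rewrite memNset; last by rewrite /= in_itv/= ltNge qx.
  rewrite mulr0 !ler0_norm; nra.
Qed.

(** The two one-sided slopes bracket the whole interval of subgradients; only the
    sign of [y - x] decides which of them is needed. *)
Lemma potential_subgrad x y p : cdf_lt nu x <= p <= cdf_le nu x ->
  (y - x) * (2 * p - 1) <= potential y - potential x.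
Proof.
move=> /andP[lp pl]; have [xy|/ltW yx] := leP x y.
  by apply: le_trans (potential_slope_right xy); nra.
by apply: le_trans (potential_slope_left yx); nra.
Qed.

Lemma potential_lip x y : `|potential y - potential x| <= `|y - x|.
Proof.
have H a b : a <= b -> `|potential b - potential a| <= `|b - a|.
  move=> ab; rewrite (ger0_norm (x := b - a)) ?subr_ge0//.
  have := potential_slope_right ab; have := potential_slope_left ab.
  have := cdf_le_ge0 nu a; have := cdf_lt_le1 nu b.
  rewrite ler_norml; move=> *; apply/andP; split; nra.
have [xy|/ltW yx] := leP x y; first exact: H.
by rewrite distrC (distrC y); exact: H.
Qed.

Lemma measurable_potential : measurable_fun setT potential.
Proof.
apply: continuous_measurable_fun => x; apply/cvgrPdist_le => e e0.
near=> y; apply: le_trans (potential_lip _ _) _.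
by near: y; apply: (@cvgr_dist_le _ _ _ _ _ id).
Unshelve. all: by end_near. Qed.

(** The subgradient inequality read at the far endpoint [x + h], which bounds
    increments from above; as [cdf_le] has both one-sided limits, the one bound
    serves both signs of h. *)
Lemma potential_incr x h :
  potential (x + h) - potential x <= h * (2 * cdf_le nu (x + h) - 1).
Proof.
have := @potential_subgrad (x + h) x (cdf_le nu (x + h)).
by rewrite cdf_lt_le lexx => /(_ isT); lra.
Qed.

End potential.

(** * Almost everywhere bounds and representatives in L_2(0,1) *)

Lemma ae_ge0_Rintegral d (T : measurableType d) (R : realType)
    (mu : {measure set T -> \bar R}) (f : T -> R) :
  measurable_fun setT f -> (\forall x \ae mu, 0 <= f x) ->
  0 <= \int[mu]_x f x.
Proof.
move=> mf f0; rewrite /Rintegral.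
rewrite (ae_eq_integral (fun x => (`|f x|)%:E))//.
- by rewrite fine_ge0// integral_ge0// => x _; rewrite lee_fin.
- exact/measurable_EFinP.
- exact/measurable_EFinP/measurableT_comp.
- have FF := ae_filter_ringOfSetsType mu.
  by apply: filterS f0 => x fx _; rewrite ger0_norm.
Qed.

Lemma ae_le_integrable d (T : measurableType d) (R : realType)
    (mu : {measure set T -> \bar R}) (f g : T -> R) :
  measurable_fun setT f -> mu.-integrable setT (EFin \o g) ->
  (\forall x \ae mu, `|f x| <= g x) -> mu.-integrable setT (EFin \o f).
Proof.
move=> mf /integrableP[mg goo] fg; apply/integrableP; split.
  exact/measurable_EFinP.
apply: le_lt_trans goo; apply: ae_ge0_le_integral => //.
- by apply: measurableT_comp => //; exact/measurable_EFinP.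
- exact: measurableT_comp.
- have FF := ae_filter_ringOfSetsType mu.
  apply: filterS fg => x fx _ /=; rewrite lee_fin.
  exact: le_trans fx (ler_norm _).
Qed.

Section L2_representatives.
Context {R : realType}.
Implicit Types u v w : L2 R.

Lemma measurable_L2 u :
  measurable_fun setT (u : measurableTypeR R -> measurableTypeR R).
Proof. exact: (measurable_funPT (repr (LebesgueSpace.sort u))). Qed.

Lemma L2_Lfun u : (u : R -> R) \in Lfun (leb01 R) 2%:E.
Proof.
rewrite inE; apply/andP; split; rewrite inE/=; last exact: Lebesgue_finite.
exact: measurable_L2.
Qed.

Lemma measurable_sqr_abse (g : measurableTypeR R -> measurableTypeR R) :
  measurable_fun setT g ->
  measurable_fun setT (fun s => `|(EFin \o g) s| `^ 2)%E.
Proof.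
move=> mg; apply: (measurableT_comp (measurable_poweR _)).
by apply: measurableT_comp => //; exact/measurable_EFinP.
Qed.

(** The class of f carries a representative of its own choice, so f is recovered
    only almost everywhere. *)
Lemma L2_of_Lfun (f : measurableTypeR R -> measurableTypeR R) :
  f \in Lfun (leb01 R) 2%:E ->
  exists w : L2 R, \forall s \ae leb01 R, w s = f s.
Proof.
move=> /andP[]; rewrite !inE/= => mf finf.
pose mfm := isMeasurableFun.Build _ _ _ _ f mf.
pose F : {mfun measurableTypeR R >-> measurableTypeR R} := HB.pack f mfm.
pose q : {mfun_ (leb01 R), measurableTypeR R >-> measurableTypeR R} :=
  (\pi F)%qT.
have qF : \forall s \ae leb01 R, (q : R -> R) s = f s.
  have : (repr q == F
    %[mod {mfun_ (leb01 R), measurableTypeR R >-> measurableTypeR R}])%qT.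
    by rewrite reprK.
  rewrite eqmodE => /asboolP; apply: filterS => s; exact.
have finq : finite_norm (leb01 R) 2%:E q.
  move: finf; rewrite /finite_norm; rewrite !unlock; congr (_ `^ _ < _)%E.
  apply: ae_eq_integral => //.
  - exact: measurable_sqr_abse.
  - exact: (measurable_sqr_abse (measurable_funPT (repr q))).
  - by apply: filterS qF => s /= ->.
pose qm := isFinLebesgue.Build _ _ _ (leb01 R) _ (lee1n 2) q finq.
pose w : L2 R := HB.pack q qm.
by exists w.
Qed.

Lemma Lfun2_bounded (f : measurableTypeR R -> measurableTypeR R) C :
  measurable_fun setT f -> (forall s, 0 < s < 1 -> `|f s| <= C) ->
  f \in Lfun (leb01 R) 2%:E.
Proof.
move=> mf fC; rewrite inE; apply/andP; split; rewrite inE//=.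
rewrite /finite_norm unlock poweR_lty//.
rewrite (@le_lt_trans _ _ (\int[leb01 R]_s (C ^+ 2)%:E)%E)//; last first.
  by rewrite integral_cst//= leb01T mule1 ltry.
apply: ae_ge0_le_integral => //.
- move=> s _; exact: poweR_ge0.
- exact: measurable_sqr_abse.
- by move=> s _; rewrite lee_fin sqr_ge0.
- apply: filterS (@ae_leb01 R) => s s01 _ /=.
  rewrite lee_fin powR_mulrn//.
  by rewrite lerXn2r ?nnegrE ?fC// (le_trans _ (fC s s01)).
Qed.

Lemma Lfun2_integrable (f : R -> R) : f \in Lfun (leb01 R) 2%:E ->
  (leb01 R).-integrable setT (EFin \o f).
Proof.
move=> f2; apply/Lfun1_integrable; apply: Lfun_subset12 f2.
by rewrite leb01T.
Qed.

Lemma Lfun2_add (f g : R -> R) :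
  f \in Lfun (leb01 R) 2%:E -> g \in Lfun (leb01 R) 2%:E ->
  f \+ g \in Lfun (leb01 R) 2%:E.
Proof. exact: (Lfun_addr_closed (leb01 R) (lee1n 2)).2. Qed.

Lemma Lfun2_sub (f g : R -> R) :
  f \in Lfun (leb01 R) 2%:E -> g \in Lfun (leb01 R) 2%:E ->
  f \- g \in Lfun (leb01 R) 2%:E.
Proof.
by move=> f2 g2; apply: Lfun2_add => //; exact: Lfun_oppr_closed.
Qed.

Lemma Lfun2_mul_integrable (f g : R -> R) :
  f \in Lfun (leb01 R) 2%:E -> g \in Lfun (leb01 R) 2%:E ->
  (leb01 R).-integrable setT (EFin \o (f \* g)).
Proof. by move=> f2 g2; apply/Lfun1_integrable; exact: Lfun2_mul_Lfun1. Qed.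

Lemma bounded_integrable (f : measurableTypeR R -> measurableTypeR R) C :
  measurable_fun setT f -> (forall s, 0 < s < 1 -> `|f s| <= C) ->
  (leb01 R).-integrable setT (EFin \o f).
Proof. by move=> mf fC; apply: Lfun2_integrable; exact: Lfun2_bounded fC. Qed.

End L2_representatives.

(** * Pointwise subgradients are subgradients *)

Section superset.
Context {R : realType} (nu : probability (measurableTypeR R) R).
Hypothesis nu2 : finite_second_moment nu.

Definition integrand (s x : R) : R := (1 - 2 * s) * x + potential nu x.

Lemma Fnu_integrand (u : L2 R) : Fnu nu u = \int[leb01 R]_s integrand s (u s).
Proof. by apply: eq_Rintegral => s _; rewrite Rintegral_quantile. Qed.

Lemma measurable_integrand (f : measurableTypeR R -> measurableTypeR R) :
  measurable_fun setT f -> measurable_fun setT (fun s => integrand s (f s)).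
Proof.
move=> mf; apply: measurable_funD.
  apply: measurable_funM => //.
  by apply: measurable_funB => //; exact: measurable_funM.
exact: measurableT_comp (measurable_potential nu2) mf.
Qed.

(** [potential] is 1-Lipschitz, so the integrand grows at most linearly in f. *)
Lemma integrable_integrand (f : measurableTypeR R -> measurableTypeR R) :
  f \in Lfun (leb01 R) 2%:E ->
  (leb01 R).-integrable setT (EFin \o (fun s => integrand s (f s))).
Proof.
move=> f2; have mf : measurable_fun setT f.
  by move: f2; rewrite inE => /andP[]; rewrite inE.
have fi := Lfun2_integrable f2.
have ci : (leb01 R).-integrable setT (EFin \o cst `|potential nu 0|).
  apply: (@bounded_integrable _ _ `|potential nu 0|) => // s _.
  by rewrite /= normr_id.
have ai := integrable_abse fi.
apply: (@ae_le_integrable _ _ _ _ _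
  (fun s => `|f s| + `|f s| + `|potential nu 0|)).
- exact: measurable_integrand.
- exact: (integrableD measurableT (integrableD measurableT ai ai) ci).
- apply: filterS (@ae_leb01 R) => s /andP[s0 s1].
  rewrite /integrand (le_trans (ler_normD _ _))// -addrA lerD//.
    rewrite normrM ler_piMl// ler_norml; lra.
  rewrite -[potential nu (f s)](subrK (potential nu 0)).
  rewrite (le_trans (ler_normD _ _))// lerD2r.
  by apply: le_trans (potential_lip nu2 _ _) _; rewrite subr0.
Qed.

Lemma L2norm_ge0 (f : R -> R) : 0 <= L2norm f.
Proof. by rewrite fine_ge0// Lnorm_ge0. Qed.

(** The functional is convex, so the inequality holds without error term and for
    all w; the radius 1 below is arbitrary. *)
Lemma subgradient_of_ae (u f : L2 R) :
  {ae leb01 R, forall s : R,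
    f s \in `[2 * cdf_lt nu (u s) - 2 * s, 2 * cdf_le nu (u s) - 2 * s]} ->
  subdifferential (Fnu nu) u f.
Proof.
move=> uf e e0; exists 1 => // w _.
have iu := integrable_integrand (L2_Lfun u).
have iw := integrable_integrand (L2_Lfun w).
have fdu : (leb01 R).-integrable setT (EFin \o (f \* (w \- u))%R).
  apply: Lfun2_mul_integrable; first exact: L2_Lfun.
  exact: Lfun2_sub (L2_Lfun w) (L2_Lfun u).
suff : 0 <= Fnu nu w - Fnu nu u - L2dot f (w \- u).
  have := mulr_ge0 (ltW e0) (L2norm_ge0 (w \- u)); lra.
rewrite !Fnu_integrand /L2dot -RintegralB// -RintegralB//; last first.
  exact: (integrableB measurableT iw iu).
apply: ae_ge0_Rintegral.
  apply: measurable_funB.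
    by apply: measurable_funB; apply: measurable_integrand; exact: measurable_L2.
  by apply: measurable_funM; [exact: measurable_L2|apply: measurable_funB;
    exact: measurable_L2].
apply: filterS uf => s; rewrite in_itv/= => /andP[lf fl].
(* [f s = 2 p - 2 s] with p between the two distribution functions *)
have := @potential_subgrad _ nu nu2 (u s) (w s) (f s / 2 + s).
rewrite /integrand.
have -> : cdf_lt nu (u s) <= f s / 2 + s <= cdf_le nu (u s).
  by apply/andP; split; lra.
move=> /(_ isT); lra.
Qed.

End superset.

(** * Subgradients satisfy the pointwise bounds *)

Section subset.
Context {R : realType} (nu : probability (measurableTypeR R) R).
Hypothesis nu2 : finite_second_moment nu.

Lemma L2norm_le (g : measurableTypeR R -> measurableTypeR R) (c : R) :
  measurable_fun setT g -> 0 <= c -> (\forall s \ae leb01 R, `|g s| <= c) ->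
  L2norm g <= c.
Proof.
move=> mg c0 gc; rewrite /L2norm.
have msqr := measurable_sqr_abse mg.
suff : ('N[leb01 R]_2 [EFin \o g] <= c%:E)%E.
  move=> h; rewrite -lee_fin fineK// ge0_fin_numE ?Lnorm_ge0//.
  by rewrite (le_lt_trans h)// ltry.
have -> : c%:E = ((c ^+ 2)%:E `^ 2^-1)%E.
  by rewrite poweR_EFin -powR_mulrn// -powRrM mulfV// powRr1.
rewrite unlock; apply: gt0_ler_poweR => //.
- by rewrite in_itv/= leey integral_ge0// => s _; exact: poweR_ge0.
- by rewrite in_itv/= leey lee_fin sqr_ge0.
have -> : (c ^+ 2)%:E = (\int[leb01 R]_s (c ^+ 2)%:E)%E.
  by rewrite integral_cst//= leb01T mule1.
apply: ae_ge0_le_integral => //.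
- by move=> s _; exact: poweR_ge0.
- by move=> s _; rewrite lee_fin sqr_ge0.
- by apply: filterS gc => s gs _ /=; rewrite lee_fin powR_mulrn// lerXn2r.
Qed.

Section one_side.
Variables (u v : L2 R) (sigma : R) (rho : R -> R).
Hypothesis sigma1 : `|sigma| = 1.
Hypothesis mrho : measurable_fun setT (rho : measurableTypeR R -> measurableTypeR R).
Hypothesis cvg_rho : forall x,
  cdf_le nu (x + sigma * n.+1%:R^-1) @[n --> \oo] --> rho x.
Hypothesis uv : subdifferential (Fnu nu) u v.

(* [sigma * v <= sigma * (2 rho - 2 s)] is the bound sought, so [gap] is its
   defect and [gap_ t] the defect before the limit t -> 0. *)
Let gap s := sigma * (v s - (2 * rho (u s) - 2 * s)).
Let gap_ t s := sigma * (v s - (2 * cdf_le nu (u s + sigma * t) - 2 * s)).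

Let measurable_gap : measurable_fun setT (gap : measurableTypeR R -> measurableTypeR R).
Proof.
apply: measurable_funM => //; apply: measurable_funB; first exact: measurable_L2.
apply: measurable_funB; last exact: measurable_funM.
by apply: measurable_funM => //; exact: measurableT_comp mrho (measurable_L2 u).
Qed.

Let measurable_gap_ t :
  measurable_fun setT (gap_ t : measurableTypeR R -> measurableTypeR R).
Proof.
apply: measurable_funM => //; apply: measurable_funB; first exact: measurable_L2.
apply: measurable_funB; last exact: measurable_funM.
apply: measurable_funM => //; apply: (measurableT_comp (measurable_cdf_le nu)).
by apply: measurable_funD => //; exact: measurable_L2.
Qed.

Let gap_bound t s : 0 < s < 1 -> `|gap_ t s| <= `|v s| + 4.
Proof.
move=> /andP[s0 s1]; rewrite normrM sigma1 mul1r (le_trans (ler_normB _ _))//.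
rewrite lerD2l ler_norml.
have := cdf_le_ge0 nu (u s + sigma * t); have := cdf_le_le1 nu (u s + sigma * t).
by move=> *; apply/andP; split; lra.
Qed.

Let integrable_bound : (leb01 R).-integrable setT (EFin \o (fun s => `|v s| + 4)).
Proof.
have vi := integrable_abse (Lfun2_integrable (L2_Lfun v)).
have ci : (leb01 R).-integrable setT (EFin \o cst 4).
  by apply: (@bounded_integrable _ _ 4) => // s _; rewrite /= ger0_norm.
exact: (integrableD measurableT vi ci).
Qed.

Variable A : set (measurableTypeR R).
Hypothesis mA : measurable A.

Let mulA_le (f : R -> R) s : `|f s * \1_A s| <= `|f s|.
Proof.
by rewrite normrM indicE; case: (s \in A); rewrite ?normr1 ?normr0 ?mulr1 ?mulr0.
Qed.

Let measurable_mulA (f : measurableTypeR R -> measurableTypeR R) :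
  measurable_fun setT f -> measurable_fun setT (fun s => f s * \1_A s).
Proof. by move=> mf; apply: measurable_funM => //; exact: measurable_indic. Qed.

Let integrable_gap_ t :
  (leb01 R).-integrable setT (EFin \o (fun s => gap_ t s * \1_A s)).
Proof.
apply: ae_le_integrable integrable_bound _.
  exact: (measurable_mulA (measurable_gap_ t)).
apply: filterS (@ae_leb01 R) => s s01.
exact: le_trans (mulA_le _ _) (gap_bound _ s01).
Qed.

(** Testing the subdifferential on [w = u + sigma t 1_A]: both [||w - u||] and the
    increments of the functional are of order t, which cancels. *)
Lemma int_gap_eventually_le e : 0 < e -> exists2 d : R, 0 < d &
  forall t, 0 < t < d -> \int[leb01 R]_s (gap_ t s * \1_A s) <= e.
Proof.
move=> e0; have [d d0 Hd] := uv e0; exists d => // t /andP[t0 td].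
have hA : (fun s => sigma * t * \1_A s) \in Lfun (leb01 R) 2%:E.
  apply: (@Lfun2_bounded _ _ t).
    by apply: measurable_funM => //; exact: measurable_indic.
  move=> s _; rewrite normrM (normrM sigma) sigma1 mul1r gtr0_norm// indicE.
  by case: (s \in A); rewrite ?normr1 ?normr0 ?mulr1 ?mulr0// ltW.
have [w wE] := L2_of_Lfun (Lfun2_add (L2_Lfun u) hA).
have mwu : measurable_fun setT (w \- u : measurableTypeR R -> measurableTypeR R).
  by apply: measurable_funB; exact: measurable_L2.
have wu_t : L2norm (w \- u) <= t.
  apply: L2norm_le => //; first exact: ltW.
  apply: filterS wE => s /= ->; rewrite addrAC subrr add0r.
  rewrite normrM (normrM sigma) sigma1 mul1r gtr0_norm// indicE.
  by case: (s \in A); rewrite ?normr1 ?normr0 ?mulr1 ?mulr0// ltW.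
have iu := integrable_integrand nu2 (L2_Lfun u).
have iw := integrable_integrand nu2 (L2_Lfun w).
have ivd : (leb01 R).-integrable setT (EFin \o (v \* (w \- u))%R).
  by apply: Lfun2_mul_integrable; [exact: L2_Lfun|
    exact: Lfun2_sub (L2_Lfun w) (L2_Lfun u)].
have ig : (leb01 R).-integrable setT (EFin \o (fun s => t * (gap_ t s * \1_A s))).
  exact: (integrableZl measurableT t (integrable_gap_ t)).
(* the error term is e * ||w - u|| <= t * e *)
rewrite -(ler_pM2l t0) -RintegralZl//.
have := Hd w (le_lt_trans wu_t td).
have : e * L2norm (w \- u) <= t * e by rewrite mulrC ler_wpM2r// ltW.
suff : 0 <= L2dot v (w \- u) - (Fnu nu w - Fnu nu u)
            - \int[leb01 R]_s (t * (gap_ t s * \1_A s)) by lra.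
rewrite !Fnu_integrand /L2dot -RintegralB// -RintegralB//; last first.
  exact: (integrableB measurableT iw iu).
rewrite -RintegralB//; last first.
  exact: (integrableB measurableT ivd (integrableB measurableT iw iu)).
apply: ae_ge0_Rintegral.
  apply: measurable_funB; last first.
    by apply: measurable_funM => //; exact: (measurable_mulA (measurable_gap_ t)).
  apply: measurable_funB.
    by apply: measurable_funM => //; exact: measurable_L2.
  by apply: measurable_funB; apply: measurable_integrand => //;
    exact: measurable_L2.
apply: filterS wE => s /= ->; rewrite /integrand /gap_ indicE.
case: (s \in A) => /=; last by rewrite !mulr0 !addr0 !subrr mulr0 subrr.
have := potential_incr nu2 (u s) (sigma * t).
rewrite !mulr1; nra.
Qed.

(** Dominated convergence along [t = 1 / (n + 1)].  Integrability of the limit is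
    part of its conclusion, and spares a bound on [rho]. *)
Lemma int_gap_le0 : \int[leb01 R]_s (gap s * \1_A s) <= 0 /\
  (leb01 R).-integrable setT (EFin \o (fun s => gap s * \1_A s)).
Proof.
pose f_ n : R -> \bar R := EFin \o (fun s => gap_ n.+1%:R^-1 s * \1_A s).
pose f : R -> \bar R := EFin \o (fun s => gap s * \1_A s).
have [|||||fi _ cvgf] := @dominated_convergence _ _ _ (leb01 R) setT measurableT
  f_ f (EFin \o (fun s => `|v s| + 4)).
- by move=> n; apply/measurable_EFinP; exact: (measurable_mulA (measurable_gap_ _)).
- by apply/measurable_EFinP; exact: (measurable_mulA measurable_gap).
- apply: nearW => s _; apply: cvg_EFin; first exact: nearW.
  apply: cvgM; last exact: cvg_cst.
  apply: cvgM; first exact: cvg_cst.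
  apply: cvgB; first exact: cvg_cst.
  apply: cvgB; last exact: cvg_cst.
  by apply: cvgM; [exact: cvg_cst|exact: cvg_rho].
- exact: integrable_bound.
- apply: filterS (@ae_leb01 R) => s s01 n _ /=.
  by rewrite lee_fin (le_trans (mulA_le _ _))// gap_bound.
split => //.
apply/ler_addgt0Pl => e e0; rewrite addr0.
rewrite -lee_fin /Rintegral fineK; last exact: integrable_fin_num.
rewrite -(cvg_lim _ cvgf)//; apply: lime_le; first exact: cvgP cvgf.
have [d d0 hd] := int_gap_eventually_le e0.
near=> n; rewrite /= -[leLHS]fineK; last first.
  exact: (integrable_fin_num measurableT (integrable_gap_ _)).
rewrite lee_fin; apply: hd; rewrite invr_gt0 ltr0Sn/=.
by near: n; exact: near_infty_natSinv_lt (PosNum d0).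
Unshelve. all: by end_near. Qed.

End one_side.

(** With A the set where the defect is positive, [defect * \1_A] is nonnegative
    with nonpositive integral, so it vanishes almost everywhere. *)
Lemma subdifferential_one_side (u v : L2 R) (sigma : R) (rho : R -> R) :
  `|sigma| = 1 ->
  measurable_fun setT (rho : measurableTypeR R -> measurableTypeR R) ->
  (forall x, cdf_le nu (x + sigma * n.+1%:R^-1) @[n --> \oo] --> rho x) ->
  subdifferential (Fnu nu) u v ->
  \forall s \ae leb01 R, sigma * (v s - (2 * rho (u s) - 2 * s)) <= 0.
Proof.
move=> sigma1 mrho cvg_rho uv.
pose gap s := sigma * (v s - (2 * rho (u s) - 2 * s)).
have mgap : measurable_fun setT (gap : measurableTypeR R -> measurableTypeR R).
  apply: measurable_funM => //; apply: measurable_funB; first exact: measurable_L2.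
  apply: measurable_funB; last exact: measurable_funM.
  by apply: measurable_funM => //; exact: measurableT_comp mrho (measurable_L2 u).
pose A : set (measurableTypeR R) := gap @^-1` `]0, +oo[.
have mA : measurable A by rewrite -[A]setTI; apply: mgap => //; exact: measurable_itv.
have [int_le0 fi] := int_gap_le0 sigma1 mrho cvg_rho uv mA.
have f0 s : 0 <= gap s * \1_A s.
  rewrite indicE; case: (boolP (s \in A)) => [|_]; last by rewrite mulr0.
  by rewrite inE /A/= in_itv/= andbT mulr1 => /ltW.
have /(ae_eq_integral_abs _ measurableT) :
  (\int[leb01 R]_s `|(gap s * \1_A s)%:E| = 0)%E.
  under eq_integral do rewrite gee0_abs ?lee_fin//.
  apply/eqP; rewrite eq_le integral_ge0 ?andbT; last first.
    by move=> s _; rewrite lee_fin.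
  by rewrite -[leLHS]fineK ?lee_fin//; exact: integrable_fin_num.
move=> /(_ (measurable_int _ fi)); apply: filterS => s /(_ I) [] h.
rewrite leNgt; apply/negP => gs; move: h; rewrite indicE mem_set; last first.
  by rewrite /A /= in_itv/= andbT.
by rewrite mulr1 => h; move: gs; rewrite -/(gap s) h ltxx.
Qed.

End subset.

(** * The subdifferential *)

Theorem lemma4p3 (R : realType) (nu : probability (measurableTypeR R) R)
    (nu2 : finite_second_moment nu) :
  (forall u : L2 R,
     subdifferential (Fnu nu) u =
     [set f : L2 R | {ae leb01 R, forall s : R,
        f s \in `[2 * cdf_lt nu (u s) - 2 * s, 2 * cdf_le nu (u s) - 2 * s]}])
  /\ subdiff_dom (Fnu nu) = [set: L2 R].
Proof.
split=> [u|].
  apply/seteqP; split => f /=; last exact: subgradient_of_ae.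
  move=> uf.
  have hi := subdifferential_one_side nu2 (normr1 _) (measurable_cdf_le nu) _ uf.
  have lo := subdifferential_one_side nu2 (normrN1 _) (measurable_cdf_lt nu) _ uf.
  apply: filterS2 (hi _) (lo _) => [s fhi flo|x|x].
  - by rewrite in_itv/=; apply/andP; split; lra.
  - by under eq_fun do rewrite mul1r; exact: cvg_cdf_le_right.
  - by under eq_fun do rewrite mulN1r; exact: cvg_cdf_le_left.
apply/seteqP; split => // u _.
(* the upper endpoint of the interval is a bounded selection *)
pose g s := 2 * cdf_le nu (u s) - 2 * s.
have g2 : g \in Lfun (leb01 R) 2%:E.
  apply: (@Lfun2_bounded _ _ 2).
    apply: measurable_funB; last exact: measurable_funM.
    apply: measurable_funM => //.
    exact: measurableT_comp (measurable_cdf_le nu) (measurable_L2 u).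
  move=> s /andP[s0 s1]; rewrite /g ler_norml.
  have := cdf_le_ge0 nu (u s); have := cdf_le_le1 nu (u s).
  by move=> *; apply/andP; split; lra.
have [f fE] := L2_of_Lfun g2.
exists f; apply: subgradient_of_ae => //; apply: filterS fE => s ->.
by rewrite in_itv/= lexx andbT lerB// ler_pM2l// cdf_lt_le.
Qed.
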